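(* Let $M_1,\dots,M_m$ be complex diagonalizable matrices of order $n_1$ and $L_1,\dots,L_l$ complex diagonalizable matrices of order $n_2$. Let $P$ be an $n_1\times k_1$ matrix and $R$ an $n_2\times k_2$ matrix, and suppose that $(M_i,P,S_i)$ is a perfect structure for each $i=1,\dots,m$ and $(L_j,R,T_j)$ is a perfect structure for each $j=1,\dots,l$ (the same $P$ for all $i$ and the same $R$ for all $j$). Then for all real numbers $\alpha_{i,j}$, $$\Big(\sum_{i=1}^m\sum_{j=1}^l \alpha_{i,j} M_i\otimes L_j\Big)(P\otimes R)=(P\otimes R)\Big(\sum_{i=1}^m\sum_{j=1}^l \alpha_{i,j} S_i\otimes T_j\Big);$$ consequently, whenever $\sum_{i,j}\alpha_{i,j}M_i\otimes L_j$ is diagonalizable, the triple $\big(\sum_{i,j}\alpha_{i,j}M_i\otimes L_j,\;P\otimes R,\;\sum_{i,j}\alpha_{i,j}S_i\otimes T_j\big)$ is a perfect structure.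
   Context: A perfect structure is a triple $(M,P,S)$ of complex matrices with $MP=PS$, where $M$ is a diagonalizable square matrix of order $n$, $P$ is an $n\times k$ matrix with $k\le n$, and $S$ is a $k\times k$ matrix. $\otimes$ denotes the Kronecker product of matrices. *)

(* Defs.v *)
From HB Require Import structures.
From mathcomp Require Export all_boot all_order all_algebra.
From mathcomp Require Export reals.
From mathcomp Require Export complex mxtens.

Set Implicit Arguments.
Unset Strict Implicit.
Unset Printing Implicit Defensive.

Local Open Scope ring_scope.
Local Open Scope complex_scope.

(* [R[i]] with [R : realType] is the field of complex numbers, and [*t] is the
   Kronecker product (row-major indexing). *)
Definition perfect_structure (R : realType) (n k : nat)
    (M : 'M[R[i]]_n) (P : 'M[R[i]]_(n, k)) (S : 'M[R[i]]_k) : Prop :=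
  [/\ diagonalizable M, (k <= n)%N & M *m P = P *m S].

(* Main.v *)
Require Import Defs.

Local Open Scope ring_scope.
Local Open Scope complex_scope.

(** By the mixed-product rule [tensmx_mul], each pair satisfies [(M i *t L j) *m (P *t Q) = (P *m S
    i) *t (Q *m T j) = (P *t Q) *m (S i *t T j)]. Since [P *t Q] is the same for all pairs, this
    relation is preserved by linear combinations. *)

Theorem theorem1 (R : realType) (m l n1 n2 k1 k2 : nat)
    (M : 'I_m -> 'M[R[i]]_n1) (L : 'I_l -> 'M[R[i]]_n2)
    (P : 'M[R[i]]_(n1, k1)) (Q : 'M[R[i]]_(n2, k2))
    (S : 'I_m -> 'M[R[i]]_k1) (T : 'I_l -> 'M[R[i]]_k2)
    (hm : (0 < m)%N) (hl : (0 < l)%N)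
    (hM : forall i, diagonalizable (M i))
    (hL : forall j, diagonalizable (L j))
    (hMPS : forall i, perfect_structure (M i) P (S i))
    (hLQT : forall j, perfect_structure (L j) Q (T j))
    (alpha : 'I_m -> 'I_l -> R) :
  let ML := \sum_(i < m) \sum_(j < l) (alpha i j)%:C *: (M i *t L j) in
  let ST := \sum_(i < m) \sum_(j < l) (alpha i j)%:C *: (S i *t T j) in
  ML *m (P *t Q) = (P *t Q) *m ST /\
  (diagonalizable ML -> perfect_structure ML (P *t Q) ST).
Proof.
move=> ML ST.
have MLPQ : ML *m (P *t Q) = (P *t Q) *m ST.
  rewrite /ML /ST mulmx_suml mulmx_sumr; apply: eq_bigr => i _.
  rewrite mulmx_suml mulmx_sumr; apply: eq_bigr => j _.
  have [_ _ MPS] := hMPS i; have [_ _ LQT] := hLQT j.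
  by rewrite -scalemxAl -scalemxAr !tensmx_mul MPS LQT.
split=> // dML; split=> //.
(* Only the size bound [k1 * k2 <= n1 * n2] remains. The bounds on [k1] and [k2] are carried by the
   members of the families, so nonemptiness is used here to pick the index 0 in each. *)
have [_ le_k1n1 _] := hMPS (Ordinal hm); have [_ le_k2n2 _] := hLQT (Ordinal hl).
exact: leq_mul.
Qed.
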